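(* Let $N$ be an $l\times n$ matrix with non-negative integer entries and columns $\mathbf b_1,\dots,\mathbf b_n$ with $\Gamma(N)=V(I_N)$ in $\bar K^n$, let $D$ be an $m\times l$ rational matrix with $M=DN$ integral (all columns nonzero), let $r_1=\mathrm{ht}(I_N)$, $r_2=\mathrm{ht}(I_M)$, $s=r_2-r_1$, and $\phi:K[x_1,\dots,x_n]\to K[t_1,\dots,t_l]$, $\phi(x_i)=\mathbf t^{\mathbf b_i}$. If there are polynomials $f_1,\dots,f_s\in I_M$ such that $\mathrm{rad}(I_{N(\ker_{\mathbb Z}(M))})=\mathrm{rad}(\phi(f_1),\dots,\phi(f_s))$, then $I_M=\mathrm{rad}(I_N+(f_1,\dots,f_s))$; in particular $I_M$ is a set-theoretic complete intersection on $I_N$.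
   Context: $K$ is a field with algebraic closure $\bar K$. $I_M$ is the toric ideal of $M$ (kernel of $x_i\mapsto\mathbf t^{\mathbf a_i}$, $\mathbf a_i$ the columns). $\Gamma(N)=\{(\mathbf T^{\mathbf b_1},\dots,\mathbf T^{\mathbf b_n}):\mathbf T\in\bar K^l\}$; $V(I_N)$ is the zero set of $I_N$ in $\bar K^n$. $\mathbf y_{\mathbf u}=\sum u_i\mathbf b_i$, $N(\ker_{\mathbb Z}(M))=\{\mathbf y_{\mathbf u}:\mathbf u\in\mathbb Z^n,M\mathbf u^T=0\}$, and $I_L=(\mathbf t^{\mathbf z_+}-\mathbf t^{\mathbf z_-}:\mathbf z\in L)$ is the lattice ideal of $L\subseteq\mathbb Z^l$. $I_M$ is a set-theoretic complete intersection on $I_N$ if $I_M=\mathrm{rad}(I_N+(f_1,\dots,f_s))$ for some $f_1,\dots,f_s\in I_M$ with $s=\mathrm{ht}(I_M)-\mathrm{ht}(I_N)$. *)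

(* Defs.v *)
From HB Require Import structures.
From mathcomp Require Import all_boot all_order all_algebra.
From mathcomp Require Import mpoly.
Set Implicit Arguments. Unset Strict Implicit. Unset Printing Implicit Defensive.
Import Order.TTheory GRing.Theory Num.Theory.
Local Open Scope ring_scope.

Section Defs.
Variable K : fieldType.

Definition pset (k : nat) := {mpoly K[k]} -> Prop.

Definition pset_eq k (I J : pset k) := forall p, I p <-> J p.
Definition pset_sub k (I J : pset k) := forall p, I p -> J p.

Definition ideal_gen k (S : pset k) : pset k := fun p =>
  exists gs : seq ({mpoly K[k]} * {mpoly K[k]}),
    (forall g, g \in gs -> S g.2) /\ p = \sum_(g <- gs) g.1 * g.2.

Definition rad_ideal k (I : pset k) : pset k := fun p => exists e : nat, I (p ^+ e).

Definition ideal_add_gens k (I : pset k) s (f : 'I_s -> {mpoly K[k]}) : pset k :=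
  ideal_gen (fun q => I q \/ exists i, q = f i).

Definition is_ideal k (I : pset k) :=
  [/\ I 0, (forall p q, I p -> I q -> I (p + q)) & (forall a p, I p -> I (a * p))].

Definition is_prime k (P : pset k) :=
  [/\ is_ideal P, ~ P 1 & (forall a b, P (a * b) -> P a \/ P b)].

Definition pset_ssub k (I J : pset k) := pset_sub I J /\ exists p, J p /\ ~ I p.

Definition prime_chain_to k (P : pset k) (h : nat) :=
  exists c : nat -> pset k,
    [/\ pset_eq (c h) P, (forall i, (i <= h)%N -> is_prime (c i))
      & (forall i, (i < h)%N -> pset_ssub (c i) (c i.+1))].

(* ht(P) = sup of lengths of such chains; ht(I) = min of ht(P), P prime containing I.
   has_height I h  <=>  ht(I) = h  (a natural number). *)
Definition has_height k (I : pset k) (h : nat) :=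
  (forall P, is_prime P -> pset_sub I P -> prime_chain_to P h) /\
  (exists P, [/\ is_prime P, pset_sub I P & ~ prime_chain_to P h.+1]).

Definition mat_mnm m n (M : 'M[int]_(m, n)) (u : 'X_{1..n}) : 'I_m -> int :=
  fun i => \sum_(j < n) M i j * (u j)%:Z.

(* toric ideal I_M = kernel of x_j |-> t^{a_j} into the Laurent ring K[t^{+-1}]:
   f is in the kernel iff, for every b in Z^m, the coefficient of t^b in the image,
   i.e. the sum of the coefficients of f at the monomials x^u with M u = b, is 0. *)
Definition toric_ideal m n (M : 'M[int]_(m, n)) : pset n := fun f =>
  forall b : 'I_m -> int,
    \sum_(u <- msupp f | [forall i, mat_mnm M u i == b i]) f@_u = 0.

Definition Nker l m n (N : 'M[nat]_(l, n)) (M : 'M[int]_(m, n)) : (('I_l -> int) -> Prop) :=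
  fun z => exists u : 'I_n -> int,
    (forall i, \sum_(j < n) M i j * u j = 0) /\
    (forall i, z i = \sum_(j < n) (N i j)%:Z * u j).

Definition zpos l (z : 'I_l -> int) : 'X_{1..l} :=
  [multinom (if (0 <= z i)%R then absz (z i) else 0%N) | i < l].
Definition zneg l (z : 'I_l -> int) : 'X_{1..l} :=
  [multinom (if (z i <= 0)%R then absz (z i) else 0%N) | i < l].

Definition lattice_ideal l (L : ('I_l -> int) -> Prop) : pset l :=
  ideal_gen (fun p => exists z, L z /\ p = 'X_[zpos z] - 'X_[zneg z]).

Definition colmnm l n (N : 'M[nat]_(l, n)) (j : 'I_n) : 'X_{1..l} :=
  [multinom N i j | i < l].

Definition phiN l n (N : 'M[nat]_(l, n)) (f : {mpoly K[n]}) : {mpoly K[l]} :=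
  mmap (@mpolyC l K) (fun j => 'X_[colmnm N j]) f.

Definition stci_on k (I J : pset k) :=
  exists r1 r2 : nat, exists f : 'I_(r2 - r1) -> {mpoly K[k]},
    [/\ has_height J r1, has_height I r2, (forall i, I (f i))
      & pset_eq I (rad_ideal (ideal_add_gens J f))].

End Defs.

Definition is_alg_closure (K : fieldType) (Kbar : closedFieldType)
  (iota : {rmorphism K -> Kbar}) :=
  forall x : Kbar, exists p : {poly K}, p != 0 /\ root (map_poly iota p) x.

Definition Gamma_eq_V (K : fieldType) (Kbar : closedFieldType)
  (iota : {rmorphism K -> Kbar}) l n (N : 'M[nat]_(l, n)) :=
  forall z : 'I_n -> Kbar,
    (exists T : 'I_l -> Kbar, forall j, z j = \prod_(i < l) T i ^+ N i j) <->
    (forall f : {mpoly K[n]}, toric_ideal (map_mx (fun x : nat => x%:Z) N) f ->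
       mmap iota z f = 0).

(* Main.v *)
(* By the Nullstellensatz it suffices that every g in I_M vanishes at every zero z of
   I_N + (f_1, ..., f_s) over the closed field. Since V(I_N) = Gamma(N), such a z is parametrized
   as z_j = T^(b_j), and f_i(z) = phi(f_i)(T) = 0. By hypothesis T is then a zero of the lattice
   ideal of N(ker M), so M u = M v implies T^(N u) = T^(N v): collecting the terms of
   g(z) = sum_u g_u T^(N u) by the value of M u makes it vanish, because g lies in I_M.
   Conversely I_M contains I_N and is radical, being the vanishing ideal of the points
   (t^(a_1), ..., t^(a_n)) of the torus, by independence of characters.
   The Nullstellensatz is proved for a prime ideal (obtained from Zorn's lemma), adjoining one
   variable at a time. *)
Require Import Defs.
From HB Require Import structures.
From mathcomp Require Import all_boot all_order all_algebra.
From mathcomp Require Import mpoly.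
From mathcomp Require Import zify.
From mathcomp Require boolp classical_sets.
Import Order.TTheory GRing.Theory Num.Theory.
Local Open Scope ring_scope.

(** * Ideals and prime ideals of commutative rings *)

(** Any commutative ring is allowed, since the induction on the number of variables runs through
    iterated univariate polynomial rings. *)
Definition ideal_set (A : comNzRingType) (I : A -> Prop) :=
  [/\ I 0, (forall p q, I p -> I q -> I (p + q)) & (forall a p, I p -> I (a * p))].

Definition prime_set (A : comNzRingType) (P : A -> Prop) :=
  [/\ ideal_set A P, ~ P 1 & (forall a b, P (a * b) -> P a \/ P b)].

Section Ideals.
Variables (A : comNzRingType) (I : A -> Prop).
Hypothesis idI : ideal_set A I.

Lemma ideal_setN p : I p -> I (- p).
Proof. by case: idI => _ _ IM Ip; rewrite -mulN1r; apply: IM. Qed.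

Lemma ideal_setB p q : I p -> I q -> I (p - q).
Proof. by case: idI => _ ID _ Ip Iq; apply: ID => //; apply: ideal_setN. Qed.

Lemma ideal_set_sum (T : Type) (r : seq T) (Q : pred T) (F : T -> A) :
  (forall i, Q i -> I (F i)) -> I (\sum_(i <- r | Q i) F i).
Proof. by case: idI => I0 ID _ IF; apply: big_ind. Qed.

Lemma ideal_set_adjoin x : ideal_set A (fun y => exists2 p, I p & exists a, y = p + a * x).
Proof.
case: idI => I0 ID IM; split.
- by exists 0 => //; exists 0; rewrite mul0r addr0.
- move=> _ _ [p Ip [a ->]] [q Iq [b ->]]; exists (p + q); first exact: ID.
  by exists (a + b); rewrite mulrDl addrACA.
- move=> b _ [p Ip [a ->]]; exists (b * p); first exact: IM.
  by exists (b * a); rewrite mulrDr mulrA.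
Qed.

End Ideals.

Lemma prime_setX (A : comNzRingType) (P : A -> Prop) : prime_set A P ->
  forall a k, P (a ^+ k) -> P a.
Proof.
case=> _ P1 Pm a; elim=> [|k IHk]; first by rewrite expr0.
by rewrite exprS => /Pm[].
Qed.

Lemma prime_set_preim (A B : comNzRingType) (psi : {rmorphism A -> B}) (P : B -> Prop) :
  prime_set B P -> prime_set A (fun a => P (psi a)).
Proof.
case=> [[P0 PD PM] P1 Pm]; split; first split.
- by rewrite rmorph0.
- by move=> p q; rewrite rmorphD; apply: PD.
- by move=> a p; rewrite rmorphM; apply: PM.
- by rewrite rmorph1.
- by move=> a b; rewrite rmorphM => /Pm.
Qed.

(** A Zorn-maximal ideal P containing J and no power of g is prime: if a and b lie outside P, then P
    + (a) and P + (b) each contain a power of g, and the product of these powers lies in P + (ab),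
    so ab is not in P. *)
Lemma exists_prime_set (A : comNzRingType) (J : A -> Prop) (g : A) :
  ideal_set A J -> (forall k, ~ J (g ^+ k)) ->
  exists P, [/\ prime_set A P, (forall a, J a -> P a) & ~ P g].
Proof.
move=> idJ Jg.
pose good X := [/\ ideal_set A X, (forall a, J a -> X a) & forall k, ~ X (g ^+ k)].
(* Zorn_bigcup also asks for the union of the empty chain, which is not an ideal. *)
have [|P [PP maxP]] := @classical_sets.Zorn_bigcup A (fun X => (forall a, ~ X a) \/ good X).
  move=> F Fgood Ftot.
  have [[X0 [FX0 gX0]]|nogood] := boolp.EM (exists X, F X /\ good X); last first.
    left=> a [X /= FX Xa]; have [X_0|gX] := Fgood X FX; first exact: (X_0 a).
    by apply: nogood; exists X.
  right.
  have memF X a : F X -> X a -> good X.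
    by move=> FX Xa; have [/(_ a)|] := Fgood X FX.
  split; first split.
  - by exists X0 => //=; case: gX0 => [[]].
  - move=> p q [X /= FX Xp] [Y /= FY Yq].
    have [XY|YX] := Ftot X Y FX FY.
      exists Y => //=; case: (memF Y q FY Yq) => [[_ YD _] _ _].
      by apply: YD => //; apply: XY.
    exists X => //=; case: (memF X p FX Xp) => [[_ XD _] _ _].
    by apply: XD => //; apply: YX.
  - move=> a p [X /= FX Xp]; exists X => //=.
    by case: (memF X p FX Xp) => [[_ _ XM] _ _]; apply: XM.
  - by move=> a Ja; exists X0 => //=; case: gX0 => _ + _; apply.
  - move=> k [X /= FX Xg]; case: (memF X _ FX Xg) => _ _ Xk; exact: (Xk k).
have gJ : good J by split.
have gP : good P.
  case: PP => // P_0; case: (maxP J); last by right.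
  by split=> [a /P_0 //|JP]; apply: (P_0 0); apply: JP; case: idJ.
case: (gP) => idP JP Pg.
have adj x : ~ P x -> exists k, exists2 p, P p & exists a, g ^+ k = p + a * x.
  move=> Px; apply: boolp.contrapT => nok.
  case: (maxP (fun y => exists2 p, P p & exists a, y = p + a * x)).
    split=> [y Py|QP]; first by exists y => //; exists 0; rewrite mul0r addr0.
    apply: Px; apply: QP; exists 0; first by case: idP.
    by exists 1; rewrite mul1r add0r.
  right; split; first exact: ideal_set_adjoin.
  - by move=> a Ja; exists a; [apply: JP | exists 0; rewrite mul0r addr0].
  - by move=> k Qk; apply: nok; exists k.
exists P; split=> //; last by have := Pg 1%N; rewrite expr1.
split=> //; first by have := Pg 0; rewrite expr0.
move=> a b Pab; have [|Pa] := boolp.EM (P a); first by left.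
have [|Pb] := boolp.EM (P b); first by right.
have [k [p Pp [c gk]]] := adj a Pa; have [k' [q Pq [d gk']]] := adj b Pb.
case: (idP) => _ PD PM; case: (Pg (k + k')%N); rewrite exprD gk gk' mulrDl.
apply: (PD); first by rewrite mulrC; apply: PM.
by rewrite mulrDr mulrACA; apply: PD; apply: PM.
Qed.

(** * Pseudo-division by a polynomial of least size *)

Section MinimalPoly.
Variables (A : idomainType) (Pc : A -> Prop) (I : {poly A} -> Prop).
Hypotheses (idPc : ideal_set A Pc) (idI : ideal_set {poly A} I).
Hypothesis PcI : forall a, Pc a -> I a%:P.

(** Take [d] of least size among the elements of [I] with a coefficient outside [Pc]. A leading term
    with coefficient in [Pc] could be cut off, giving a shorter such element; a pseudo-remainder by
    [d] is in [I] and shorter than [d]. *)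
Lemma exists_minimal_poly p i : I p -> ~ Pc p`_i ->
  exists d, [/\ I d, ~ Pc (lead_coef d),
    (forall h, I h -> (size h < size d)%N -> forall j, Pc h`_j)
    & (forall h, I h -> forall j, Pc (h %% d)`_j)].
Proof.
case: (idPc) => Pc0 PcD _; case: (idI) => _ _ IM.
have [n] := ubnP (size p); elim: n p i => // n IHn p i le_p Ip Pci.
have [[q [Iq lt_q [j Pcj]]]|smaller] := boolp.EM
    (exists q, [/\ I q, (size q < size p)%N & exists j, ~ Pc q`_j]).
  by apply: (IHn q j) => //; apply: leq_trans lt_q _.
have minp h : I h -> (size h < size p)%N -> forall j, Pc h`_j.
  move=> Ih lt_h j; apply: boolp.contrapT => Pcj.
  by apply: smaller; exists h; split=> //; exists j.
have p0 : p != 0 by apply/eqP => p_eq0; apply: Pci; rewrite p_eq0 coef0.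
have lcp : ~ Pc (lead_coef p).
  move=> Plc; pose t := lead_coef p *: 'X^((size p).-1).
  have coeft j : Pc t`_j.
    by rewrite coefZ coefXn; case: eqP => _; rewrite ?mulr1 ?mulr0.
  have It : I t by rewrite /t -mul_polyC mulrC; apply: IM; apply: PcI.
  have pt : (size (p - t)%R < size p)%N.
    rewrite -[X in (_ < X)%N]prednK ?size_poly_gt0 // ltnS; apply/leq_sizeP => j.
    rewrite leq_eqVlt => /predU1P[<-|lt_j].
      by rewrite coefB coefZ coefXn eqxx mulr1 subrr.
    rewrite coefB coefZ coefXn gtn_eqF // mulr0 subr0 nth_default //.
    by rewrite -(prednK (n := size p)) ?size_poly_gt0.
  apply: Pci; rewrite -[p](subrK t) coefD; apply: PcD => //.
  by apply: minp => //; apply: ideal_setB.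
exists p; split=> // h Ih; apply: minp; last by rewrite ltn_modp.
(* Over a domain, division by [p] works after scaling [h] by a power of [lead_coef p]; the remainder
   is still a combination of elements of [I]. *)
have -> : h %% p = lead_coef p ^+ scalp h p *: h - h %/ p * p.
  by rewrite Pdiv.Idomain.divp_eq addrC addKr.
by apply: ideal_setB => //; rewrite -?mul_polyC; apply: IM.
Qed.

End MinimalPoly.

(** * Zeros of prime ideals, one variable at a time *)

Section ExtensionToPoly.
Variables (K : fieldType) (F : closedFieldType) (iota : {rmorphism K -> F}).

(** A point with coordinates in [F] is a ring map [chi] extending [iota]. Asking for [chi g != 0]
    lets the induction step keep chosen leading coefficients nonzero. *)
Definition primes_have_zeros (A : comNzRingType) (e : {rmorphism K -> A}) :=
  forall P g, prime_set A P -> ~ P g ->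
  exists chi : {rmorphism A -> F},
    [/\ forall c, chi (e c) = iota c, forall p, P p -> chi p = 0 & chi g != 0].

Lemma primes_have_zeros_field : primes_have_zeros K idfun.
Proof.
move=> P g [[P0 _ PM] P1 _] Pg; exists iota; split=> //.
  move=> p Pp; have [->|p0] := eqVneq p 0; first by rewrite rmorph0.
  by case: P1; rewrite -(mulVf p0); apply: PM.
by rewrite fmorph_eq0; apply/eqP => g0; apply: Pg; rewrite g0.
Qed.

(** [p - 1] has a root unless it is a nonzero constant, in which case [p] is itself a constant. *)
Lemma exists_nonroot (p : {poly F}) : p != 0 -> exists b, p.[b] != 0.
Proof.
move=> p0; have [/closed_rootP[b]|] := boolP (size (p - 1) != 1).
  by rewrite /root hornerD hornerN hornerC subr_eq0 => /eqP pb; exists b; rewrite pb oner_neq0.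
rewrite negbK => /size_poly1P[c _ pc]; exists 0.
have pE : p = (c + 1)%:P by rewrite polyCD -pc subrK.
by rewrite pE hornerC; apply: contraNneq p0 => c0; rewrite pE c0.
Qed.

(* Let P' be the prime of constants lying in P. If P is not P'[X], take d0 in P and d1 in P + (g) of
   least size among the elements outside P'[X]. Pseudo-division by d0 shows that a zero of P' at
   which lead_coef d0 does not vanish extends to a zero of P by any root of d0; pseudo-division
   of d0 and of g by d1 shows that d1 is a constant, so that g does not vanish at this zero when
   d1 does not. *)
Lemma primes_have_zeros_poly (A : idomainType) (e : {rmorphism K -> A}) :
  primes_have_zeros A e -> primes_have_zeros {poly A} (polyC \o e).
Proof.
move=> zeros_A P g primeP Pg.
pose Pc a := P a%:P.
have primePc : prime_set A Pc by apply: prime_set_preim.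
have [[idP P1 Pm] [idPc _ Pcm]] := (primeP, primePc).
have [[P0 PD PM] [Pc0 PcD PcM]] := (idP, idPc).
have PcP (p : {poly A}) : (forall i, Pc p`_i) -> P p.
  move=> Pp; rewrite -[p]coefK poly_def; apply: ideal_set_sum => // i _.
  by rewrite -mul_polyC mulrC; apply: PM; apply: Pp.
have extend (chi : {rmorphism A -> F}) b : (forall c, chi (e c) = iota c) ->
    (forall p, P p -> (map_poly chi p).[b] = 0) -> (map_poly chi g).[b] != 0 ->
    exists chi' : {rmorphism {poly A} -> F}, [/\ forall c, chi' ((polyC \o e) c) = iota c,
      forall p, P p -> chi' p = 0 & chi' g != 0].
  move=> chie chiP chig; exists (horner_eval b \o map_poly chi); split=> //= c.
  by rewrite /horner_eval map_polyC hornerC /= chie.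
have coefPc chi b (r : {poly A}) : (forall p, Pc p -> chi p = 0 :> F) ->
    (forall i, Pc r`_i) -> (map_poly chi r).[b] = 0.
  move=> chiP Pr; suff -> : map_poly chi r = 0 by rewrite horner0.
  by rewrite /map_poly poly_def big1 // => i _; rewrite chiP // scale0r.
have [[p [Pp [i Pci]]]|trans] := boolp.EM (exists p, P p /\ exists i, ~ Pc p`_i); last first.
  (* Here [P] consists of the polynomials with all coefficients in [Pc], so [g] has a coefficient
     outside [Pc]. A zero of [Pc] not killing it leaves a nonzero image of [g], and any non-root of
     that image completes the point. *)
  have PPc p : P p -> forall i, Pc p`_i.
    by move=> Pp i; apply: boolp.contrapT => Pci; apply: trans; exists p; split=> //; exists i.
  have [i Pci] : exists i, ~ Pc g`_i.
    by apply: boolp.contrapT => gPc; apply: Pg; apply: PcP => i;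
      apply: boolp.contrapT => Pci; apply: gPc; exists i.
  have [chi [chie chiP chig]] := zeros_A Pc _ primePc Pci.
  have [|b gb] := @exists_nonroot (map_poly chi g).
    by apply: contraNneq chig => g0; rewrite -coef_map /= g0 coef0.
  by apply: (extend chi b) => // p /PPc Pp; apply: coefPc.
have [d0 [Pd0 lc0 min0 div0]] := @exists_minimal_poly A Pc P idPc idP (fun _ => id) p i Pp Pci.
pose I (y : {poly A}) := exists2 p, P p & exists a, y = p + a * g.
have idI : ideal_set {poly A} I by apply: ideal_set_adjoin.
have PI q : P q -> I q by exists q => //; exists 0; rewrite mul0r addr0.
have [d1 [Id1 lc1 _ div1]] := @exists_minimal_poly A Pc I idPc idI
  (fun a Pa => PI _ Pa) p i (PI _ Pp) Pci.
have Ig : I g by exists 0 => //; exists 1; rewrite mul1r add0r.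
have nz0 : d0 != 0 by apply/eqP => d0_0; apply: lc0; rewrite d0_0 lead_coef0.
have nz1 : d1 != 0 by apply/eqP => d1_0; apply: lc1; rewrite d1_0 lead_coef0.
have Pscale a (h : {poly A}) : P (a *: h) -> Pc a \/ P h by rewrite -mul_polyC => /Pm.
have size_d1 : (size d1 <= 1)%N.
  rewrite leqNgt; apply/negP => gt1.
  have := Pdiv.Idomain.divp_eq d0 d1; set q := d0 %/ d1; set r := d0 %% d1 => d0E.
  have Pr : P r by apply: PcP; apply: div1; apply: PI.
  have Pqd : P (q * d1).
    rewrite -[q * d1](addrK r) -d0E; apply: ideal_setB => //.
    by rewrite -mul_polyC; apply: PM.
  (* If [q] is in [P], it is shorter than [d0], so its coefficients lie in [Pc], and so does
     [lead_coef d0] times a power of [lead_coef d1]. If [d1] is in [P], pseudo-division of [g] puts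
     [g] times such a power in [P]. Primality excludes both. *)
  have [Pq|Pd1] := Pm _ _ Pqd.
    have qPc : forall j, Pc q`_j.
      apply: min0 => //; rewrite /q Pdiv.Idomain.size_divp //.
      by rewrite ltn_subrL -subn1 subn_gt0 gt1 size_poly_gt0.
    have : Pc (lead_coef d1 ^+ scalp d0 d1 * lead_coef d0).
      rewrite -coefZ d0E coefD; apply: PcD; last by apply: div1; apply: PI.
      rewrite coefM; apply: ideal_set_sum => // j _.
      by rewrite mulrC; apply: PcM; apply: qPc.
    by case/Pcm => // /(prime_setX _ _ primePc).
  have : P (lead_coef d1 ^+ scalp g d1 *: g).
    rewrite Pdiv.Idomain.divp_eq; apply: PD; first exact: PM.
    by apply: PcP; apply: div1.
  by case/Pscale => // /(prime_setX _ _ primePc).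
(* The first factor preserves the degree of [d0], which yields a root [b]; the second keeps the
   constant [d1] nonzero at the point. *)
have : ~ Pc (lead_coef d0 * lead_coef d1) by case/Pcm.
move=> /(zeros_A Pc _ primePc)[chi [chie chiP]].
rewrite rmorphM mulf_eq0 negb_or => /andP[chi0 chi1].
have sz : size (map_poly chi d0) = size d0 by rewrite size_map_poly_id0.
have [b /rootP d0b] : exists b, root (map_poly chi d0) b.
  (* A constant [d0] in [P] would have its leading coefficient in [Pc]. *)
  apply/closed_rootP; rewrite sz; apply/eqP => /eqP /size_poly1P[c _ d0c].
  by apply: lc0; rewrite d0c lead_coefC /Pc -d0c.
have chiPb q : P q -> (map_poly chi q).[b] = 0.
  move=> Pq; have := congr1 (fun h => (map_poly chi h).[b]) (Pdiv.Idomain.divp_eq q d0).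
  rewrite rmorphD rmorphM /= hornerD hornerM d0b mulr0 add0r.
  rewrite [RHS](coefPc chi) //; last exact: div0.
  rewrite map_polyZ /= hornerZ => /eqP.
  by rewrite mulf_eq0 rmorphXn expf_eq0 (negPf chi0) andbF => /eqP.
apply: (extend chi b) => //.
case: Id1 => q Pq [a d1E]; apply: contraNneq chi1 => gb.
have := congr1 (fun h => (map_poly chi h).[b]) d1E.
rewrite rmorphD rmorphM /= hornerD hornerM gb mulr0 addr0 (chiPb _ Pq).
by rewrite (size1_polyC size_d1) lead_coefC map_polyC hornerC => /eqP.
Qed.

End ExtensionToPoly.

(** * Iterated polynomial rings and the Nullstellensatz *)

(** [A] is [K] with [n] variables adjoined successively; its mapping property is what links it to
    [{mpoly K[n]}]. *)
Lemma exists_affine_space (K : fieldType) (F : closedFieldType)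
  (iota : {rmorphism K -> F}) (n : nat) :
  exists (A : idomainType) (e : {rmorphism K -> A}) (x : 'I_n -> A),
    primes_have_zeros K F iota A e /\
    forall (B : comNzRingType) (h : {rmorphism K -> B}) (y : 'I_n -> B),
    exists psi : {rmorphism A -> B}, (forall c, psi (e c) = h c) /\ forall i, psi (x i) = y i.
Proof.
elim: n => [|n [A [e [x [zeros univ]]]]].
  exists K, idfun, (fun=> 0); split; first exact: primes_have_zeros_field.
  by move=> B h y; exists h; split=> // -[].
exists {poly A}, (polyC \o e), (fun i => if unlift ord0 i is Some j then (x j)%:P else 'X).
split=> [|B h y]; first exact: primes_have_zeros_poly.
have [psi [psie psix]] := univ B h (fun j => y (lift ord0 j)).
exists (horner_eval (y ord0) \o map_poly psi); split=> [c|i] /=.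
  by rewrite /horner_eval map_polyC hornerC /= psie.
rewrite /horner_eval; case: unliftP => [j|] ->; first by rewrite map_polyC hornerC /= psix.
by rewrite map_polyX hornerX.
Qed.

(** If no power of [g] lies in [J], a prime containing [J] and avoiding [g], pulled back to [A], has
    a zero [chi]; the coordinates [chi (x i)] form a zero of [J] at which [g] does not vanish. *)
Lemma nullstellensatz (K : fieldType) (F : closedFieldType) (iota : {rmorphism K -> F})
  (n : nat) (J : pset K n) (g : {mpoly K[n]}) :
  is_ideal J ->
  (forall z : 'I_n -> F, (forall p, J p -> mmap iota z p = 0) -> mmap iota z g = 0) ->
  rad_ideal J g.
Proof.
move=> idJ Jg; apply: boolp.contrapT => radg.
have [|P [primeP JP Pg]] := @exists_prime_set {mpoly K[n]} J g idJ.
  by move=> k Jk; apply: radg; exists k.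
have [A [e [x [zeros univ]]]] := exists_affine_space K F iota n.
have [psi [psie psix]] := univ {mpoly K[n]} (@mpolyC n K) (fun i => 'X_i).
(* [mmap e x] is a section of [psi], so the pulled-back prime avoids the lift of [g]. *)
have psiK p : psi (mmap e x p) = p.
  rewrite [RHS]mpolyE /mmap rmorph_sum; apply: eq_bigr => m _.
  rewrite rmorphM /= psie mul_mpolyC -mmap1_id /mmap1 rmorph_prod.
  by congr (_ *: _); apply: eq_bigr => i _; rewrite rmorphXn /= psix.
have [||chi [chie chiP]] := zeros (fun a => P (psi a)) (mmap e x g).
- exact: prime_set_preim.
- by rewrite psiK.
have chi_mmap p : chi (mmap e x p) = mmap iota (fun i => chi (x i)) p.
  rewrite /mmap rmorph_sum; apply: eq_bigr => m _; rewrite rmorphM chie /mmap1 rmorph_prod.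
  by congr (_ * _); apply: eq_bigr => i _; rewrite rmorphXn.
rewrite chi_mmap Jg ?eqxx // => p Jp.
by rewrite -chi_mmap chiP // psiK; apply: JP.
Qed.

(** * Independence of characters *)

Lemma big_fibers (T U : eqType) (V : nmodType) (h : T -> U) (r : seq T) (E : T -> V) :
  \sum_(u <- r) E u = \sum_(b <- undup (map h r)) \sum_(u <- r | h u == b) E u.
Proof.
under [RHS]eq_bigr => b _ do rewrite big_mkcond.
rewrite exchange_big /= [LHS]big_seq [RHS]big_seq; apply: eq_bigr => u ru.
rewrite (bigD1_seq (h u)) ?undup_uniq ?mem_undup ?map_f //= eqxx big1 ?addr0 // => b.
by rewrite eq_sym => /negPf ->.
Qed.

(* Dedekind's independence of characters, on a multiplicatively closed part D of G. *)
Lemma characters_independent (F : fieldType) (B : eqType) (G : Type) (op : G -> G -> G)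
  (D : G -> Prop) (chi : B -> G -> F) :
  (forall s t, D s -> D t -> D (op s t)) ->
  (forall b s t, D s -> D t -> chi b (op s t) = chi b s * chi b t) ->
  (forall b, exists2 t, D t & chi b t != 0) ->
  (forall b b', b != b' -> exists2 t, D t & chi b t != chi b' t) ->
  forall (r : seq B) (c : B -> F), uniq r ->
  (forall t, D t -> \sum_(b <- r) c b * chi b t = 0) ->
  {in r, forall b, c b = 0}.
Proof.
move=> Dop chiM chi_neq0 chi_sep; elim=> [|b0 r IHr] c //= /andP[b0r uniq_r] sum0.
have c_r : {in r, forall b, c b = 0}.
  move=> b rb; have [|a Da chi_a] := chi_sep b b0; first by apply: contraNneq b0r => <-.
  have suma t : D t -> \sum_(b' <- r) c b' * (chi b' a - chi b0 a) * chi b' t = 0.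
    move=> Dt.
    (* The relation at [op a t] minus [chi b0 a] times the relation at [t] no longer involves
       [b0]. *)
    transitivity (\sum_(b <- b0 :: r) c b * chi b (op a t) -
                  chi b0 a * \sum_(b <- b0 :: r) c b * chi b t).
      rewrite !big_cons mulrDr opprD addrACA chiM // mulrCA subrr add0r.
      rewrite mulr_sumr -sumrB; apply: eq_bigr => b' _.
      by rewrite chiM // mulrBr mulrBl !mulrA [c b' * chi b0 a]mulrC.
    by rewrite !sum0 ?mulr0 ?subrr //; apply: Dop.
  have /eqP := IHr (fun b' => c b' * (chi b' a - chi b0 a)) uniq_r suma b rb.
  by rewrite mulf_eq0 subr_eq0 (negPf chi_a) orbF => /eqP.
move=> b; rewrite inE => /predU1P[->|/c_r //]; have [t Dt chi_t] := chi_neq0 b0.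
have := sum0 t Dt; rewrite big_cons big_seq big1 ?addr0 => [/eqP|b' rb'].
  by rewrite mulf_eq0 (negPf chi_t) orbF => /eqP.
by rewrite c_r // mul0r.
Qed.

(** A root x of (X^k - 1) X - 1 satisfies (x^k - 1) x = 1, so neither factor vanishes, in any
    characteristic. *)
Lemma exists_non_unity_root (F : closedFieldType) (k : nat) :
  (0 < k)%N -> exists2 x : F, x != 0 & x ^+ k != 1.
Proof.
move=> k0; have sz : size (('X^k - 1) * 'X : {poly F}) = k.+2.
  by rewrite size_mulX -?size_poly_eq0 size_Xn_sub_1.
have : size (('X^k - 1) * 'X - 1 : {poly F}) != 1.
  by rewrite size_polyDl sz // size_polyN size_poly1.
case/closed_rootP => x /rootP; rewrite !hornerE /= => /eqP.
rewrite subr_eq0 => /eqP x1; exists x; apply: contra_eqN x1 => /eqP ->.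
  by rewrite mulr0 eq_sym oner_neq0.
by rewrite subrr mul0r eq_sym oner_neq0.
Qed.

(** * Toric ideals as vanishing ideals of torus points *)

Section ToricIdeal.
Variables (K : fieldType) (m n : nat) (M : 'M[int]_(m, n)).

(** A finite function, so that exponents have the boolean equality used to group terms by fibres. *)
Definition mat_mnm_ffun (u : 'X_{1..n}) : {ffun 'I_m -> int} := [ffun i => mat_mnm M u i].

Lemma mat_mnm_ffunE (u : 'X_{1..n}) (b : {ffun 'I_m -> int}) :
  [forall i, mat_mnm M u i == b i] = (mat_mnm_ffun u == b).
Proof.
apply/forallP/eqP => [ub|<- i]; last by rewrite ffunE.
by apply/ffunP => i; rewrite ffunE; apply/eqP.
Qed.

(** On each fibre of [M] the weight is constant and factors out of a coefficient sum equal to 0.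
    Torus characters, monomials at points of Gamma(N) and indicators of fibres all serve as [w]. *)
Lemma toric_ideal_sum0 (S : comNzRingType) (h : {rmorphism K -> S}) (f : {mpoly K[n]})
  (w : 'X_{1..n} -> S) : toric_ideal M f ->
  (forall u v, mat_mnm M u =1 mat_mnm M v -> w u = w v) ->
  \sum_(u <- msupp f) h f@_u * w u = 0.
Proof.
move=> Mf wM; rewrite (big_fibers _ _ _ mat_mnm_ffun) big_seq big1 // => b.
rewrite mem_undup => /mapP[u _ ->].
rewrite (eq_bigr (fun v => h f@_v * w u)) => [|v /eqP/ffunP vu]; last first.
  by congr (_ * _); apply: wM => i; have := vu i; rewrite !ffunE.
rewrite -mulr_suml -rmorph_sum -[X in h X](_ : 0 = _) ?rmorph0 ?mul0r //.
rewrite -[LHS](Mf (mat_mnm_ffun u)); apply: eq_bigl => v; exact: mat_mnm_ffunE.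
Qed.

Section Torus.
Variables (F : closedFieldType) (iota : {rmorphism K -> F}).

Definition torus_character (b : 'I_m -> int) (t : 'I_m -> F) := \prod_(i < m) t i ^ b i.

Definition torus_point (t : 'I_m -> F) (j : 'I_n) : F := torus_character (fun i => M i j) t.

Lemma mmap_torus_point (t : 'I_m -> F) (f : {mpoly K[n]}) : (forall i, t i != 0) ->
  mmap iota (torus_point t) f =
  \sum_(u <- msupp f) iota f@_u * torus_character (mat_mnm_ffun u) t.
Proof.
move=> t0; apply: eq_bigr => u _; congr (_ * _).
rewrite /mmap1 /torus_point /torus_character.
under eq_bigr => j _ do rewrite -prodrXl.
rewrite exchange_big; apply: eq_bigr => i _; rewrite ffunE /mat_mnm.
rewrite (big_morph (fun k : int => t i ^ k) (id1 := 1) (op1 := *%R)) //.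
  by apply: eq_bigr => j _; rewrite exprnP exprz_exp.
by move=> a b; rewrite expfzDr.
Qed.

(** On the torus, [f] becomes a combination of characters whose coefficients are the fibre sums of
    [f]; independence of characters forces these to be 0. *)
Lemma toric_idealP (f : {mpoly K[n]}) :
  toric_ideal M f <->
  forall t : 'I_m -> F, (forall i, t i != 0) -> mmap iota (torus_point t) f = 0.
Proof.
split=> [Mf t t0|f0 b].
  rewrite mmap_torus_point //; apply: toric_ideal_sum0 => // u v uv.
  by apply: eq_bigr => i _; rewrite !ffunE uv.
pose bf : {ffun 'I_m -> int} := [ffun i => b i].
have -> : \sum_(u <- msupp f | [forall i, mat_mnm M u i == b i]) f@_u =
          \sum_(u <- msupp f | mat_mnm_ffun u == bf) f@_u.
  by apply: eq_bigl => u; rewrite -mat_mnm_ffunE; under [RHS]eq_forallb do rewrite ffunE.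
have [supp_b|nsupp_b] := boolP (bf \in undup (map mat_mnm_ffun (msupp f))); last first.
  rewrite big_seq_cond big1 // => u /andP[fu /eqP ub].
  by move: nsupp_b; rewrite mem_undup -ub map_f.
apply: (fmorph_inj iota); rewrite rmorph0 rmorph_sum.
pose chi (c : {ffun 'I_m -> int}) (t : 'I_m -> F) := torus_character c t.
apply: (@characters_independent F _ _ (fun s t i => s i * t i)
  (fun t : 'I_m -> F => forall i, t i != 0) chi _ _ _ _ _
  (fun b => \sum_(u <- msupp f | mat_mnm_ffun u == b) iota f@_u) (undup_uniq _) _ _ supp_b).
- by move=> s t s0 t0 i; rewrite mulf_neq0.
- move=> c s t _ _; rewrite /chi /torus_character -big_split.
  by apply: eq_bigr => i _; rewrite /= expfzMl.
- move=> c; exists (fun=> 1) => [i|]; first exact: oner_neq0.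
  by rewrite /chi /torus_character big1 ?oner_neq0 // => i _; rewrite exp1rz.
- move=> c c' cc'; have [i cci] : exists i, c i != c' i.
    apply/existsP; apply: contraNT cc' => /existsPn eqc.
    by apply/eqP/ffunP => i; apply/eqP; rewrite -[_ == _]negbK.
  (* At the point with [x] in coordinate [i] and 1 elsewhere, the two characters agree only if
     [x ^ (c i - c' i) = 1]. *)
  have [|x x0 xk] := @exists_non_unity_root F `|c i - c' i|%N.
    by rewrite absz_gt0 subr_eq0.
  exists (fun j => if j == i then x else 1) => [j|]; first by case: ifP => _; rewrite ?oner_neq0.
  have chix d : chi d (fun j => if j == i then x else 1) = x ^ d i.
    rewrite /chi /torus_character (bigD1 i) //= eqxx big1 ?mulr1 // => j /negPf ->.
    by rewrite exp1rz.
  rewrite !chix; apply: contraNneq xk => xcc.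
  have : x ^ (c i - c' i) = 1 by rewrite expfzDr // xcc -expfzDr // subrr expr0z.
  case: (c i - c' i) => k /=; first by rewrite -exprnP => ->.
  by rewrite NegzE -exprnN => /(canRL invrK) ->; rewrite invr1.
move=> t t0; rewrite -[RHS](f0 t t0) mmap_torus_point // (big_fibers _ _ _ mat_mnm_ffun).
apply: eq_bigr => c _; rewrite mulr_suml; apply: eq_bigr => u /eqP <-.
by [].
Qed.

End Torus.
End ToricIdeal.

(** * Generated ideals and their zeros *)

Lemma ideal_gen_ideal (K : fieldType) (n : nat) (S : pset K n) : is_ideal (ideal_gen S).
Proof.
split.
- by exists [::]; split=> //; rewrite big_nil.
- move=> _ _ [r [rS ->]] [s [sS ->]]; exists (r ++ s); split; last by rewrite big_cat.
  by move=> g; rewrite mem_cat => /orP[/rS|/sS].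
- move=> a _ [r [rS ->]]; exists [seq (a * g.1, g.2) | g <- r]; split.
    by move=> _ /mapP[g /rS Sg ->].
  by rewrite big_map mulr_sumr; apply: eq_bigr => g _; rewrite mulrA.
Qed.

Lemma ideal_gen_mem (K : fieldType) (n : nat) (S : pset K n) p : S p -> ideal_gen S p.
Proof.
move=> Sp; exists [:: (1, p)]; split; last by rewrite big_seq1 mul1r.
by move=> g; rewrite inE => /eqP ->.
Qed.

Lemma mmap_rad_ideal0 (K F : fieldType) (iota : {rmorphism K -> F}) (n : nat)
  (z : 'I_n -> F) (S : pset K n) p :
  (forall q, S q -> mmap iota z q = 0) -> rad_ideal (ideal_gen S) p -> mmap iota z p = 0.
Proof.
move=> Sz [e [r [rS pE]]]; have : mmap iota z (p ^+ e) = 0.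
  rewrite pE rmorph_sum big_seq big1 // => g /rS /Sz g0.
  by rewrite rmorphM /= g0 mulr0.
by rewrite rmorphXn => /eqP; rewrite expf_eq0 => /andP[_ /eqP].
Qed.

(** * Evaluation at monomially parametrized points *)

Section Monomials.
Variables (l n : nat) (N : 'M[nat]_(l, n)).

Definition monomial_map (F : fieldType) (T : 'I_l -> F) (j : 'I_n) : F :=
  \prod_(i < l) T i ^+ N i j.

Lemma mmap1_monomial_map (F : fieldType) (T : 'I_l -> F) (u : 'X_{1..n}) :
  mmap1 (monomial_map F T) u = \prod_(i < l) T i ^+ (\sum_(j < n) N i j * u j)%N.
Proof.
rewrite /mmap1 /monomial_map; under eq_bigr => j _ do rewrite -prodrXl.
rewrite exchange_big; apply: eq_bigr => i _; rewrite expr_sum.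
by apply: eq_bigr => j _; rewrite exprM.
Qed.

Lemma mmap_phiN (K F : fieldType) (iota : {rmorphism K -> F}) (T : 'I_l -> F)
  (f : {mpoly K[n]}) : mmap iota T (phiN N f) = mmap iota (monomial_map F T) f.
Proof.
rewrite /phiN [mmap (@mpolyC l K) _ f]/mmap rmorph_sum; apply: eq_bigr => u _.
rewrite rmorphM /= mmapC /mmap1 rmorph_prod; congr (_ * _).
apply: eq_bigr => j _; rewrite rmorphXn /= mmapX; congr (_ ^+ _).
by apply: eq_bigr => i _; rewrite mnmE.
Qed.

(** With c the componentwise minimum of a and b, a = c + z+ and b = c + z-, so T^c is a common
    factor. Nothing is divided, so T may have zero coordinates. *)
Lemma monomials_agree (F : fieldType) (T : 'I_l -> F) (z : 'I_l -> int) (a b : 'I_l -> nat) :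
  (forall i, z i = (a i)%:Z - (b i)%:Z) -> mmap1 T (zpos z) = mmap1 T (zneg z) ->
  \prod_(i < l) T i ^+ a i = \prod_(i < l) T i ^+ b i.
Proof.
move=> zE Tz.
have aE i : a i = (minn (a i) (b i) + zpos z i)%N.
  by rewrite mnmE zE; case: ifP; lia.
have bE i : b i = (minn (a i) (b i) + zneg z i)%N.
  by rewrite mnmE zE; case: ifP; lia.
under eq_bigr => i _ do rewrite aE exprD.
under [RHS]eq_bigr => i _ do rewrite bE exprD.
by rewrite !big_split /=; congr (_ * _).
Qed.

End Monomials.

(** * The inclusion of I_N in I_M *)

(** The indicator of the fibre of [M] over [b] is constant on the fibres of [N], so it can be the
    weight in [toric_ideal_sum0]. *)
Lemma toric_ideal_sub (K : fieldType) (l m n : nat) (N : 'M[int]_(l, n)) (M : 'M[int]_(m, n)) :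
  (forall u v, mat_mnm N u =1 mat_mnm N v -> mat_mnm M u =1 mat_mnm M v) ->
  forall f, @toric_ideal K _ _ N f -> toric_ideal M f.
Proof.
move=> NM f Nf b; rewrite big_mkcond.
rewrite -[RHS](toric_ideal_sum0 K l n N K idfun f
  (fun u => [forall i, mat_mnm M u i == b i]%:R) Nf); last first.
  by move=> u v /NM uv; congr (_%:R); congr nat_of_bool; apply: eq_forallb => i; rewrite uv.
by apply: eq_bigr => u _; case: ifP; rewrite ?mulr1 ?mulr0.
Qed.

Lemma mat_mnm_factor (l m n : nat) (N : 'M[int]_(l, n)) (M : 'M[int]_(m, n)) (D : 'M[rat]_(m, l)) :
  map_mx (fun x : int => x%:~R) M = D *m map_mx (fun x : int => x%:~R) N ->
  forall u v, mat_mnm N u =1 mat_mnm N v -> mat_mnm M u =1 mat_mnm M v.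
Proof.
move=> MDN u v uv i.
have matE (p : nat) (B : 'M[int]_(p, n)) (w : 'X_{1..n}) k :
    (mat_mnm B w k)%:~R = (map_mx (fun x : int => x%:~R) B *m \col_j (w j)%:R) k 0 :> rat.
  rewrite /mat_mnm mxE rmorph_sum; apply: eq_bigr => j _.
  by rewrite !mxE rmorphM.
apply: (intr_inj (R := rat)); rewrite !matE MDN -!mulmxA !mxE.
by apply: eq_bigr => k _; rewrite -!matE uv.
Qed.

Theorem theorem5p3 (K : fieldType) (Kbar : closedFieldType)
  (iota : {rmorphism K -> Kbar}) (l m n : nat)
  (N : 'M[nat]_(l, n)) (D : 'M[rat]_(m, l)) (M : 'M[int]_(m, n))
  (r1 r2 : nat) (f : 'I_(r2 - r1) -> {mpoly K[n]}) :
  is_alg_closure iota ->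
  Gamma_eq_V iota N ->
  map_mx (fun x : int => x%:~R) M = D *m map_mx (fun x : nat => x%:R) N ->
  (forall j : 'I_n, col j M != 0) ->
  has_height (@toric_ideal K _ _ (map_mx (fun x : nat => x%:Z) N)) r1 ->
  has_height (@toric_ideal K _ _ M) r2 ->
  (forall i, @toric_ideal K _ _ M (f i)) ->
  pset_eq (rad_ideal (@lattice_ideal K l (Nker N M)))
          (rad_ideal (ideal_gen (fun q => exists i, q = phiN N (f i)))) ->
  pset_eq (@toric_ideal K _ _ M)
          (rad_ideal (ideal_add_gens (@toric_ideal K _ _ (map_mx (fun x : nat => x%:Z) N)) f))
  /\ stci_on (@toric_ideal K _ _ M) (@toric_ideal K _ _ (map_mx (fun x : nat => x%:Z) N)).
Proof.
move=> _ GammaV MDN _ ht1 ht2 If radL.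
set IN := toric_ideal (map_mx _ N) in GammaV ht1 *; set IM := toric_ideal M in ht2 If *.
have NM : forall u v, mat_mnm (map_mx (fun x : nat => x%:Z) N) u =1
    mat_mnm (map_mx (fun x : nat => x%:Z) N) v -> mat_mnm M u =1 mat_mnm M v.
  by apply: (mat_mnm_factor _ _ _ _ _ D); rewrite MDN; congr (_ *m _); apply/matrixP => i j; rewrite !mxE.
suff IM_rad : pset_eq IM (rad_ideal (ideal_add_gens IN f)).
  by split=> //; exists r1, r2, f.
move=> g; split=> [IMg|radg]; last first.
  (* I_N and the [f i] vanish at all torus points of [M], hence so does everything in the radical
     they generate. *)
  apply/(toric_idealP _ _ _ _ _ iota) => t t0; apply: mmap_rad_ideal0 radg => q [INq|[i ->]].
    by move: t t0; apply/(toric_idealP _ _ _ _ _ iota); apply: toric_ideal_sub INq.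
  by move: t t0; apply/(toric_idealP _ _ _ _ _ iota); apply: If.
apply: (nullstellensatz _ _ iota); first exact: ideal_gen_ideal.
move=> z zJ; have /GammaV[T zT] : forall p, IN p -> mmap iota z p = 0.
  by move=> p INp; apply: zJ; apply: ideal_gen_mem; left.
have eval_z p : mmap iota z p = mmap iota (monomial_map l n N Kbar T) p.
  by apply: eq_bigr => u _; congr (_ * _); apply: mmap1_eq.
have Lz y : Nker N M y -> mmap1 T (zpos y) = mmap1 T (zneg y).
  move=> Ly; apply/eqP; rewrite -subr_eq0 -!(mmapX T iota) -rmorphB; apply/eqP.
  have /radL : rad_ideal (@lattice_ideal K l (Nker N M)) ('X_[zpos y] - 'X_[zneg y]).
    by exists 1%N; rewrite expr1; apply: ideal_gen_mem; exists y.
  apply: mmap_rad_ideal0 => _ [i ->]; rewrite mmap_phiN -eval_z.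
  by apply: zJ; apply: ideal_gen_mem; right; exists i.
rewrite eval_z; apply: toric_ideal_sum0 IMg _ => u v uv.
rewrite !mmap1_monomial_map.
(* [y] is N (u - v), which lies in [Nker N M] because M u = M v. *)
pose y i := (\sum_(j < n) N i j * u j)%N%:Z - (\sum_(j < n) N i j * v j)%N%:Z.
apply: (monomials_agree _ _ _ y) => //; apply: Lz.
exists (fun j => (u j)%:Z - (v j)%:Z); split=> i.
  under eq_bigr => j _ do rewrite mulrBr.
  by rewrite sumrB; apply/eqP; rewrite subr_eq0; apply/eqP/uv.
rewrite /y !(big_morph Posz PoszD (erefl _)) -sumrB; apply: eq_bigr => j _.
by rewrite !PoszM mulrBr.
Qed.
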